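(* Let $\rho_1:G_1\to\mathrm{GL}(V_1)$ and $\rho_2:G_2\to\mathrm{GL}(V_2)$ be SV-representations of finite groups with central characters $\psi_1,\psi_2$, and let $\alpha:G_1\to G_2$ be a group isomorphism (so $\alpha(Z(G_1))=Z(G_2)$). Then: (1) a linear isomorphism $T:V_1\to V_2$ with $T\circ\rho_1(g)=\rho_2(\alpha(g))\circ T$ for all $g\in G_1$ exists if and only if $\psi_1=\psi_2\circ\alpha$ on $Z(G_1)$; (2) such an isomorphism $T$, if it exists, is unique up to multiplication by a non-zero scalar; (3) if $\rho_1,\rho_2$ are unitary with respect to positive-definite Hermitian forms $\langle\cdot,\cdot\rangle_1$ on $V_1$ and $\langle\cdot,\cdot\rangle_2$ on $V_2$, and $T$ is such an isomorphism, then $T$ can be taken (after rescaling) to satisfy $\langle Tv,Tw\rangle_2=\langle v,w\rangle_1$ for all $v,w\in V_1$, and it is then unique up to multiplication by an element of $\mathbb{T}=\{z\in\mathbb{C}:|z|=1\}$.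
   Context: A representation $\rho:G\to\mathrm{GL}(V)$ of a finite group $G$ with centre $Z$, $\dim V=s$, is an SV-representation if it is irreducible and $|G/Z|=s^2$ (equivalently, irreducible with character vanishing outside $Z$). For irreducible $\rho$, the central character $\psi:Z\to\mathbb{C}^\times$ is defined by $\rho(z)=\psi(z)\mathrm{id}_V$. *)

(* Defs.v *)
From HB Require Import structures.
From mathcomp Require Import all_boot all_order all_fingroup all_algebra.
From mathcomp Require Import all_solvable.
From mathcomp Require Import reals complex.

Set Implicit Arguments.
Unset Strict Implicit.
Unset Printing Implicit Defensive.

Import Order.TTheory GRing.Theory Num.Theory.
Local Open Scope ring_scope.

(* mathcomp's mx_representation is a right action on row vectors; here a
   representation is a left action on an abstract finite-dimensional space, so
   that it composes like a homomorphism G -> GL(V).  Each rho g with g in G is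
   invertible, with inverse rho g^-1. *)
Record representation (F : fieldType) (gT : finGroupType) (G : {group gT})
    (V : vectType F) := Representation {
  repr_fun :> gT -> 'End(V);
  repr_fun1 : repr_fun 1%g = \1%VF;
  repr_funM : {in G &, forall g h,
    repr_fun (g * h)%g = (repr_fun g \o repr_fun h)%VF}
}.

Section Representations.

Variables (F : fieldType) (gT : finGroupType) (G : {group gT}).
Variables (V : vectType F) (rho : representation G V).

Definition stable_subspace (U : {vspace V}) : Prop :=
  forall g, g \in G -> (rho g @: U <= U)%VS.

Definition irreducible_repr : Prop :=
  {:V}%VS <> 0%VS /\
  forall U : {vspace V}, stable_subspace U -> U = 0%VS \/ U = {:V}%VS.

Definition SV_representation : Prop :=
  irreducible_repr /\ #|(G / 'Z(G))%g| = (\dim {:V} ^ 2)%N.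

(* The values of psi outside 'Z(G) are irrelevant; on 'Z(G) the equation
   determines psi as soon as V is nonzero. *)
Definition central_character (psi : gT -> F) : Prop :=
  forall z, z \in 'Z(G)%g -> rho z = psi z *: \1%VF.

End Representations.

Definition equivariant_iso (F : fieldType) (gT1 gT2 : finGroupType)
    (G1 : {group gT1}) (G2 : {group gT2}) (V1 V2 : vectType F)
    (rho1 : representation G1 V1) (rho2 : representation G2 V2)
    (alpha : gT1 -> gT2) (T : 'Hom(V1, V2)) : Prop :=
  bijective T /\
  forall g, g \in G1 -> (T \o rho1 g)%VF = (rho2 (alpha g) \o T)%VF.

Definition unitary_repr (C : numClosedFieldType) (gT : finGroupType)
    (G : {group gT}) (V : vectType C) (rho : representation G V)
    (form : {dot V for Num.conj}) : Prop :=
  forall g, g \in G -> isometry form form (rho g).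

(* Main.v *)
Require Import Defs.
From HB Require Import structures.
From mathcomp Require Import all_boot all_order all_fingroup all_algebra.
From mathcomp Require Import all_solvable.
From mathcomp Require Import reals complex.
From mathcomp Require Import mxrepresentation.

Set Implicit Arguments.
Unset Strict Implicit.
Unset Printing Implicit Defensive.

Import Order.TTheory GRing.Theory Num.Theory.
Local Open Scope ring_scope.

(* Transporting rho2 along alpha reduces everything to two representations rho,
   sigma of one group G.  By Burnside's theorem the operators rho g of an
   irreducible rho span End(V); for an SV-representation there are only
   (dim V)^2 central cosets, so coset representatives act by a basis of End(V).
   Hence, when the central characters agree, the averages
   sum_g sigma(g) A rho(g)^-1 cannot vanish for all A, and a nonzero one is an
   isomorphism by Schur's lemma.  Burnside's theorem also gives uniqueness, and
   the proportionality of the two invariant forms on V1, since it turns every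
   endomorphism, and its adjoint, into a combination of group elements. *)

(** * Linear algebra: rank-one maps, dimension of Hom spaces, bijectivity *)

Section RankOne.

Variables (F : fieldType) (V W : vectType F).

Definition rank_one (phi : {scalar V}) (w : W) (x : V) : W := phi x *: w.

Fact rank_one_is_linear phi w : linear (rank_one phi w).
Proof. by move=> a x y; rewrite /rank_one linearP scalerDl scalerA. Qed.

HB.instance Definition _ phi w :=
  GRing.isLinear.Build F V W _ (rank_one phi w) (rank_one_is_linear phi w).

Lemma scalar_witness (v : V) : v != 0 -> exists phi : {scalar V}, phi v = 1.
Proof.
move=> v0; exists (coord [tuple v] ord0).
by have /= -> := @coord_free _ _ _ [tuple v] ord0 ord0 _; rewrite ?seq1_free.
Qed.

Lemma lfun_neq0P (f : 'Hom(V, W)) : f != 0 -> exists v, f v != 0.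
Proof.
have [fv0 | nzf] := eqVneq (limg f) 0%VS.
  case/eqP; apply/lfunP=> v; rewrite lfunE /=.
  by apply/eqP; rewrite -memv0 -fv0 memv_img ?memvf.
have /memv_imgP[v _ vE] := memv_pick (limg f).
by exists v; rewrite -vE vpick0.
Qed.

Lemma dim_Hom : \dim {: 'Hom(V, W)} = (\dim {:V} * \dim {:W})%N.
Proof. by rewrite !dimvf. Qed.

Lemma lfun_bijective (f : 'Hom(V, W)) :
  lker f = 0%VS -> limg f = fullv -> bijective f.
Proof.
move=> /eqP kf lf; exists (f^-1)%VF; first exact: lker0_lfunK.
by move=> w; rewrite limg_lfunVK // lf memvf.
Qed.

End RankOne.

(** * Operators of a single representation *)

Section Representation.

Variables (F : fieldType) (gT : finGroupType) (G : {group gT}).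
Variables (V : vectType F) (rho : representation G V).

Lemma reprME g h x : g \in G -> h \in G -> rho (g * h)%g x = rho g (rho h x).
Proof. by move=> Gg Gh; rewrite repr_funM // lfunE. Qed.

Lemma reprK g : g \in G -> cancel (rho g) (rho g^-1%g).
Proof.
by move=> Gg x; rewrite -reprME ?groupV // mulVg repr_fun1 lfunE.
Qed.

Lemma reprVK g : g \in G -> cancel (rho g^-1%g) (rho g).
Proof.
by move=> Gg x; rewrite -reprME ?groupV // mulgV repr_fun1 lfunE.
Qed.

Lemma irreducible_neq0 : irreducible_repr rho -> exists v : V, v != 0.
Proof.
by case=> /eqP V0 _; exists (vpick {:V}); rewrite vpick0.
Qed.

End Representation.

(** * Intertwiners: Schur's lemma and averaging over the group *)

Section Intertwiners.

Variables (F : fieldType) (gT : finGroupType) (G : {group gT}).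
Variables (V W : vectType F).
Variables (rho : representation G V) (sigma : representation G W).

Definition intertwines (T : 'Hom(V, W)) :=
  forall g, g \in G -> (T \o rho g)%VF = (sigma g \o T)%VF.

Lemma intertwinesE T g x :
  intertwines T -> g \in G -> T (rho g x) = sigma g (T x).
Proof. by move=> TG Gg; have /lfunP/(_ x) := TG g Gg; rewrite !lfunE. Qed.

(** The kernel and the image of [T] are stable, so irreducibility leaves only the trivial choices,
    and [T != 0] excludes the wrong one in each case. *)
Lemma schur_bijective T :
  irreducible_repr rho -> irreducible_repr sigma ->
  intertwines T -> T != 0 -> bijective T.
Proof.
move=> [_ irr1] [_ irr2] TG nzT; apply: lfun_bijective.
- case: (irr1 (lker T)) => // [g Gg | kT].
    apply/subvP=> _ /memv_imgP[x xT ->]; move: xT; rewrite !memv_ker.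
    by rewrite intertwinesE // => /eqP ->; rewrite linear0.
  case/eqP: nzT; apply/lfunP=> x; rewrite lfunE /=.
  by apply/eqP; rewrite -memv_ker kT memvf.
- case: (irr2 (limg T)) => // [g Gg | iT].
    apply/subvP=> _ /memv_imgP[_ /memv_imgP[x _ ->] ->].
    by rewrite -intertwinesE // memv_img ?memvf.
  case/eqP: nzT; apply/lfunP=> x; rewrite lfunE /=.
  by apply/eqP; rewrite -memv0 -iT memv_img ?memvf.
Qed.

Definition average (A : 'Hom(V, W)) : 'Hom(V, W) :=
  \sum_(g in G) (sigma g \o (A \o rho g^-1%g))%VF.

Lemma average_intertwines A : intertwines (average A).
Proof.
move=> h Gh; apply/lfunP=> x; rewrite !comp_lfunE /average !sum_lfunE linear_sum.
rewrite (reindex_inj (mulgI h)) /=; apply: eq_big => [g | g Ghg].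
  by rewrite groupMl.
have Gg: g \in G by rewrite -(groupMl _ Gh).
by rewrite !comp_lfunE reprME // invMg reprME ?groupV // reprK.
Qed.

End Intertwiners.

(** * Burnside's theorem and scalar endomorphisms *)

(* mathcomp's representations multiply row vectors on the right, so that
   [g |-> rho g^-1], and not [g |-> rho g], becomes a morphism in matrix form. *)
Section Burnside.

Import passmx.

Variables (F : closedFieldType) (gT : finGroupType) (G : {group gT}).
Variables (V : vectType F) (rho : representation G V).

Let e := vbasis {:V}.
Let eP : basis_of {:V} e := vbasisP {:V}.

Fact repr_mx_subproof : mx_repr G (fun g => mxof e e (rho g^-1%g)).
Proof.
split=> [|g h Gg Gh]; first by rewrite invg1 repr_fun1 mxof1 // (basis_free eP).
by rewrite invMg repr_funM ?groupV // (mxof_comp _ _ eP).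
Qed.

Let rG := MxRepresentation repr_mx_subproof.

(** Over an algebraically closed field an irreducible matrix representation is absolutely
    irreducible, so its operators span the full matrix algebra. *)
Lemma burnside : irreducible_repr rho ->
  forall f : 'End(V), exists c : gT -> F, f = \sum_(g in G) c g *: rho g.
Proof.
case=> nzV irr; have irrG : mx_irreducible rG.
  apply/mx_irrP; split=> [|U Umod nzU]; first by rewrite lt0n dimv_eq0; apply/eqP.
  case: (irr (vsof e U)) => [g Gg | /eqP | UV].
  - apply/subvP=> _ /memv_imgP[x xU ->].
    rewrite -(rVof_sub eP) (rVof_app _ eP).
    have /mxmoduleP/(_ g^-1%g) := Umod; rewrite groupV /= invgK => /(_ Gg).
    by apply: submx_trans; rewrite submxMr ?(rVof_sub eP).
  - by rewrite vsof_eq0 // (negPf nzU).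
  - by rewrite -sub1mx -(sub_vsof eP) UV subvf.
have /mx_abs_irrP[_ [a aP]] := group_closure_closed_field irrG.
(* The matrix form attaches [rho g^-1] to [g], hence the inversion in the coefficients and the
   reindexing below. *)
move=> f; exists (fun g => a g^-1%g (mxof e e f)).
apply: (can_inj (mxofK eP eP)); rewrite [LHS]aP linear_sum /=.
rewrite (reindex_inj invg_inj) /=; apply: eq_big => [g | g Gg].
  by rewrite groupV.
by rewrite linearZ /= invgK.
Qed.

(** By [burnside], [S] commutes with every endomorphism. Commuting with the rank-one map that sends
    [v0] to [w] gives [S w = phi (S v0) *: w], with a factor independent of [w]. *)
Lemma schur_scalar (S : 'End(V)) : irreducible_repr rho ->
  intertwines rho rho S -> exists c : F, S = c *: \1%VF.
Proof.
move=> irr SG; have [v0 nzv0] := irreducible_neq0 irr.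
have [phi phi1] := scalar_witness nzv0.
exists (phi (S v0)); apply/lfunP=> w; rewrite scale_lfunE id_lfunE.
have [c cE] := burnside irr (linfun (rank_one phi w)).
have Scomm x : S (linfun (rank_one phi w) x) = linfun (rank_one phi w) (S x).
  rewrite cE !sum_lfunE linear_sum; apply: eq_bigr => g Gg.
  by rewrite !scale_lfunE linearZ /= (intertwinesE _ SG).
by have := Scomm v0; rewrite !lfunE /= /rank_one phi1 scale1r.
Qed.

End Burnside.

(** * Central cosets in an SV-representation *)

Section SVExistence.

Variables (F : closedFieldType) (gT : finGroupType) (G : {group gT}).
Variables (V : vectType F) (rho : representation G V) (psi : gT -> F).
Hypotheses (SV : SV_representation rho) (psiP : central_character rho psi).

(* Modulo the centre the operators [rho g] span ['End(V)] and there are only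
   [(\dim V) ^ 2] of them. *)
Lemma SV_coset_free (c : {set gT} -> F) :
  \sum_(C in rcosets 'Z(G)%g G) c C *: rho (repr C) = 0 ->
  forall C, C \in rcosets 'Z(G)%g G -> c C = 0.
Proof.
have [irr cardGZ] := SV; set P := rcosets 'Z(G)%g G.
pose X := [tuple rho (repr (enum_val i)) | i < #|P|].
have sZG : 'Z(G)%g \subset G := center_sub G.
have Xfree : free X.
  (* A spanning family no longer than the dimension is a basis; the length here is the index of the
     centre, that is, the dimension of ['End(V)]. *)
  suff : basis_of {: 'End(V)} X by apply: basis_free.
  rewrite basisEdim size_tuple dim_Hom mulnn -cardGZ.
  rewrite card_quotient ?gFnorm // leqnn andbT.
  apply/subvP=> f _; have [a ->] := burnside irr f.
  apply: rpred_sum => g Gg; apply: rpredZ.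
  have Pg : ('Z(G) :* g)%g \in P by apply/rcosetsP; exists g.
  have /rcosetP[z Zz rE] := mem_repr_rcoset 'Z(G)%G g.
  have Gr : repr ('Z(G) :* g)%g \in G by rewrite rE groupM // (subsetP sZG).
  have -> : g = (z^-1 * repr ('Z(G) :* g)%g)%g by rewrite rE mulKg.
  rewrite repr_funM ?groupV ?(subsetP sZG _ Zz) // psiP ?groupV //.
  rewrite -comp_lfunZl comp_lfun1l rpredZ // memv_span //.
  apply/tnthP; exists (enum_rank_in Pg ('Z(G) :* g)%g).
  by rewrite tnth_mktuple enum_rankK_in.
rewrite big_enum_val /= => sum0 C PC.
have /freeP/(_ (fun i => c (enum_val i))) := Xfree.
rewrite -(enum_rankK_in PC PC); apply.
rewrite -[RHS]sum0; apply: eq_bigr => i _.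
by rewrite -tnth_nth tnth_mktuple.
Qed.

End SVExistence.

(** * Existence of an intertwiner *)

Section SVIso.

Variables (C : numClosedFieldType) (gT : finGroupType) (G : {group gT}).
Variables (V W : vectType C).
Variables (rho : representation G V) (sigma : representation G W).
Variable psi : gT -> C.
Hypotheses (SVrho : SV_representation rho) (SVsigma : SV_representation sigma).
Hypotheses (rhoP : central_character rho psi).
Hypotheses (sigmaP : central_character sigma psi).

(* If every average vanished, pairing the average of [v |-> phi v *: w] with
   [v1] would give a linear relation between the [sigma g] with coefficients
   [phi (rho g^-1 v1)]; grouped by central cosets it is trivial, although the
   coefficient at [g = 1] is [phi v1 = 1]. *)
Lemma SV_average_neq0 : exists A : 'Hom(V, W), average rho sigma A != 0.
Proof.
have [irr _] := SVrho; have [v1 nzv1] := irreducible_neq0 irr.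
have [phi phi1] := scalar_witness nzv1; set Z := 'Z(G)%g.
have sZG : Z \subset G := center_sub G.
pose c g := phi (rho g^-1%g v1); pose S := \sum_(g in G) c g *: sigma g.
suff /lfun_neq0P[w] : S != 0.
  move=> nzSw; exists (linfun (rank_one phi w)); apply: contraNneq nzSw => T0.
  have /lfunP/(_ v1) := T0; rewrite [RHS]lfunE /= => <-.
  rewrite /S /average !sum_lfunE; apply/eqP/eq_bigr => g Gg.
  by rewrite scale_lfunE !comp_lfunE lfunE /= /rank_one linearZ.
apply/eqP=> S0.
have ZP : (Z : {set gT}) \in rcosets Z G.
  by apply/rcosetsP; exists 1%g; rewrite ?mulg1 ?group1.
suff rel0 : \sum_(D in rcosets Z G) (c (repr D) *+ #|Z|) *: sigma (repr D) = 0.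
  (* The coset [Z] has representative 1, so its coefficient is the order of [Z], which is nonzero in
     characteristic 0. *)
  have /eqP := SV_coset_free SVsigma sigmaP rel0 ZP.
  rewrite repr_group /c invg1 repr_fun1 id_lfunE phi1.
  by rewrite pnatr_eq0 eqn0Ngt cardG_gt0.
rewrite -[RHS]S0 /S (set_partition_big _ (rcosets_partition sZG)) /=.
apply: eq_bigr => _ /rcosetsP[h Gh ->].
rewrite -scalerMnl -(card_rcoset _ h) -sumr_const; apply: eq_bigr => g gP.
have [z Zz ->] : exists2 z, z \in Z & g = (z * repr (Z :* h))%g.
  by apply/rcosetP; rewrite rcoset_repr.
have Gr : repr (Z :* h)%g \in G.
  have /rcosetP[y Zy ->] := mem_repr_rcoset 'Z(G)%G h.
  by rewrite groupM // (subsetP sZG).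
have Gz : z \in G := subsetP sZG z Zz.
(* Replacing [g] by [z * g] multiplies [sigma g] by [psi z] and [c g] by its inverse, because the
   central characters agree. The summands are therefore constant on each central coset. *)
have psiz : psi z *: rho z^-1%g v1 = v1.
  have /lfunP/(_ (rho z^-1%g v1)) := rhoP Zz.
  by rewrite reprVK // scale_lfunE id_lfunE => <-.
rewrite /c invMg reprME ?groupV // [in RHS]repr_funM // (sigmaP Zz).
by rewrite -comp_lfunZl comp_lfun1l scalerA mulrC -[_ * _]linearZ -linearZ psiz.
Qed.

Lemma SV_intertwiner :
  exists2 T : 'Hom(V, W), intertwines rho sigma T & bijective T.
Proof.
have [A nzA] := SV_average_neq0; have AG := average_intertwines rho sigma A.
exists (average rho sigma A) => //.
by apply: schur_bijective AG nzA; [case: SVrho | case: SVsigma].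
Qed.

End SVIso.

(** The composite of [T'] with the inverse of [T] intertwines [rho] with itself, hence is a
    scalar. *)
Lemma intertwiner_uniq (F : closedFieldType) (gT : finGroupType)
    (G : {group gT}) (V W : vectType F)
    (rho : representation G V) (sigma : representation G W) (T T' : 'Hom(V, W)) :
  irreducible_repr rho ->
  intertwines rho sigma T -> bijective T ->
  intertwines rho sigma T' -> bijective T' ->
  exists2 c : F, c != 0 & T' = c *: T.
Proof.
move=> irr TG bijT T'G bijT'.
have kT : lker T == 0%VS by apply/lker0P/bij_inj.
have T_onto w : T (T^-1%VF w) = w.
  have [f _ fK] := bijT; rewrite limg_lfunVK //.
  by rewrite -(fK w) memv_img ?memvf.
have [|c cE] := @schur_scalar _ _ _ _ rho (T^-1 \o T')%VF irr.
  move=> g Gg; apply/lfunP=> x; rewrite !comp_lfunE; apply: (bij_inj bijT).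
  by rewrite T_onto (intertwinesE _ TG) // T_onto (intertwinesE _ T'G).
have T'E : T' = c *: T.
  apply/lfunP=> x; rewrite scale_lfunE -linearZ /= -[T' x]T_onto; congr (T _).
  by have /lfunP/(_ x) := cE; rewrite comp_lfunE scale_lfunE id_lfunE.
exists c => //; apply/eqP=> c0; have [v nzv] := irreducible_neq0 irr.
case/eqP: nzv; apply: (bij_inj bijT').
by rewrite T'E c0 scale0r !lfunE.
Qed.

(** * Invariant Hermitian forms *)

Section Unitary.

Variables (C : numClosedFieldType) (gT : finGroupType) (G : {group gT}).
Variables (V : vectType C) (rho : representation G V).

(** The adjoint of the combination with coefficients [c], for any invariant form: a unitary operator
    has its inverse as adjoint. *)
Definition adjoint_sum (c : gT -> C) : 'End(V) :=
  \sum_(g in G) (c g)^* *: rho g^-1%g.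

(** Including [T] covers both forms to be compared: the identity gives an invariant form on [V]
    itself, a general intertwiner the pullback of one on [W]. *)
Lemma unitary_adjoint (W : vectType C) (sigma : representation G W)
    (k : {dot W for Num.conj}) (T : 'Hom(V, W)) c x y :
  unitary_repr sigma k -> intertwines rho sigma T ->
  k (T ((\sum_(g in G) c g *: rho g) x)) (T y) = k (T x) (T (adjoint_sum c y)).
Proof.
move=> uk TG; rewrite /adjoint_sum !sum_lfunE !linear_sum linear_sumlz.
apply: eq_bigr => g Gg; rewrite !scale_lfunE !linearZ /= linearZl_LR /=.
rewrite conjCK -[T y in LHS](reprVK sigma Gg) (intertwinesE _ TG) // uk //.
by rewrite (intertwinesE _ TG) ?groupV.
Qed.

(* The adjoint of [x |-> h x v0 *: u] with respect to [h] is
   [y |-> h y u *: v0]; by Burnside both are combinations of the group action,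
   so they are adjoint also for the form [k] pulled back along [T]. *)
Lemma unitary_form_proportional (W : vectType C) (sigma : representation G W)
    (h : {dot V for Num.conj}) (k : {dot W for Num.conj})
    (T : 'Hom(V, W)) v0 u w :
  irreducible_repr rho -> unitary_repr rho h -> unitary_repr sigma k ->
  intertwines rho sigma T ->
  h v0 v0 * k (T u) (T w) = h u w * k (T v0) (T v0).
Proof.
move=> irr uh uk TG.
have [c cE] := burnside irr (linfun (rank_one (applyr h v0) u)).
have AE x : (\sum_(g in G) c g *: rho g) x = h x v0 *: u.
  by rewrite -cE lfunE.
have huw : (h w u)^* = h u w by rewrite (hermC h u w) expr0 mul1r.
have hD x : h x (adjoint_sum c w - h w u *: v0) = 0.
  have rho1 : intertwines rho rho \1%VF.
    by move=> g _; rewrite comp_lfun1l comp_lfun1r.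
  have := unitary_adjoint c x w uh rho1; rewrite !id_lfunE AE => hE.
  rewrite linearBr /= -hE linearZl_LR linearZr_LR /= huw.
  by rewrite mulrC subrr.
have adjE : adjoint_sum c w = h w u *: v0.
  (* The difference is orthogonal to every vector, in particular to itself, so definiteness of [h]
     kills it. *)
  by apply/eqP; rewrite -subr_eq0 -(dnorm_eq0 h) hD.
have := unitary_adjoint c v0 w uk TG.
rewrite AE adjE !linearZ /= linearZl_LR /= => ->.
by rewrite huw.
Qed.

End Unitary.

(** * Transport along the group isomorphism *)

Section Pullback.

Variables (F : fieldType) (gT1 gT2 : finGroupType).
Variables (G1 : {group gT1}) (G2 : {group gT2}) (V : vectType F).
Variables (rho : representation G2 V) (alpha : {morphism G1 >-> gT2}).
Hypothesis alpha_iso : isom G1 G2 alpha.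

Let aG : (alpha @* G1)%g = G2 := isom_im alpha_iso.

Fact pullback1 : rho (alpha 1%g) = \1%VF.
Proof. by rewrite morph1 repr_fun1. Qed.

Fact pullbackM : {in G1 &, forall g h,
  rho (alpha (g * h)%g) = (rho (alpha g) \o rho (alpha h))%VF}.
Proof.
by move=> g h Gg Gh; rewrite morphM // repr_funM // -aG mem_morphim.
Qed.

(** With this encoding, equivariance along [alpha] is, by conversion, intertwining with the
    pullback. *)
Definition pullback : representation G1 V := Representation pullback1 pullbackM.

Lemma isom_center : (alpha @* 'Z(G1))%g = 'Z(G2)%g.
Proof. by rewrite -aG injm_center ?(isom_inj alpha_iso). Qed.

Lemma pullback_irreducible : irreducible_repr rho -> irreducible_repr pullback.
Proof.
case=> nz irr; split=> // U Ust; apply: irr => h.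
by rewrite -aG => /morphimP[g Gg _ ->]; apply: Ust.
Qed.

Lemma pullback_SV : SV_representation rho -> SV_representation pullback.
Proof.
case=> irr cardGZ; split; first exact: pullback_irreducible.
rewrite -cardGZ !card_quotient ?gFnorm // -!divgS ?center_sub //.
have injalpha := isom_inj alpha_iso.
by rewrite /= -isom_center -aG !card_injm ?center_sub.
Qed.

Lemma pullback_central_character psi :
  central_character rho psi -> central_character pullback (psi \o alpha).
Proof.
move=> psiP z Zz; apply: psiP; rewrite -isom_center.
by rewrite mem_morphim // (subsetP (center_sub G1)).
Qed.

End Pullback.

Theorem theorem2p3 (R : realType) (gT1 gT2 : finGroupType)
    (G1 : {group gT1}) (G2 : {group gT2})
    (V1 V2 : vectType R[i])
    (rho1 : representation G1 V1) (rho2 : representation G2 V2)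
    (SV1 : SV_representation rho1) (SV2 : SV_representation rho2)
    (psi1 : gT1 -> R[i]) (psi2 : gT2 -> R[i])
    (psi1P : central_character rho1 psi1)
    (psi2P : central_character rho2 psi2)
    (alpha : {morphism G1 >-> gT2}) (alpha_iso : isom G1 G2 alpha) :
  [/\ (exists T : 'Hom(V1, V2), equivariant_iso rho1 rho2 alpha T) <->
        (forall z, z \in 'Z(G1)%g -> psi1 z = psi2 (alpha z)),
      (forall T T' : 'Hom(V1, V2),
        equivariant_iso rho1 rho2 alpha T ->
        equivariant_iso rho1 rho2 alpha T' ->
        exists2 c : R[i], c != 0 & T' = c *: T)
    & forall (form1 : {dot V1 for Num.conj}) (form2 : {dot V2 for Num.conj}),
        unitary_repr rho1 form1 -> unitary_repr rho2 form2 ->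
        (forall T : 'Hom(V1, V2),
          equivariant_iso rho1 rho2 alpha T ->
          exists2 c : R[i], c != 0 & isometry form2 form1 (c *: T)) /\
        (forall T T' : 'Hom(V1, V2),
          equivariant_iso rho1 rho2 alpha T -> isometry form2 form1 T ->
          equivariant_iso rho1 rho2 alpha T' -> isometry form2 form1 T' ->
          exists2 z : R[i], `|z| = 1 & T' = z *: T)].

Proof.
pose rho2' := pullback rho2 alpha_iso.
have SV2' : SV_representation rho2' := pullback_SV alpha_iso SV2.
have psi2P' : central_character rho2' (psi2 \o alpha).
  exact: pullback_central_character.
have [irr1 _] := SV1; have [v0 nzv0] := irreducible_neq0 irr1.
have uniqT T T' : equivariant_iso rho1 rho2 alpha T ->
    equivariant_iso rho1 rho2 alpha T' -> exists2 c : R[i], c != 0 & T' = c *: T.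
  move=> [bT TG] [bT' TG'].
  exact: (intertwiner_uniq (sigma := rho2') irr1 TG bT TG' bT').
split=> //.
- split=> [[T [bijT TG]] z Zz | psiE].
    have G1z : z \in G1 := subsetP (center_sub G1) z Zz.
    have := intertwinesE v0 (sigma := rho2') TG G1z.
    (* On the centre, equivariance at [v0] reads [psi1 z *: T v0 = psi2 (alpha z) *: T v0], and
       [T v0] is nonzero by injectivity. *)
    rewrite psi1P // psi2P' // !scale_lfunE !id_lfunE linearZ /=.
    move/eqP; rewrite -subr_eq0 -scalerBl scaler_eq0 subr_eq0.
    case/orP=> [/eqP // | /eqP Tv0].
    by case/eqP: nzv0; apply: (bij_inj bijT); rewrite Tv0 linear0.
  have psi1P' : central_character rho1 (psi2 \o alpha).
    by move=> z Zz; rewrite psi1P // psiE.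
  by have [T TG bT] := SV_intertwiner SV1 SV2' psi1P' psi2P'; exists T.
- move=> form1 form2 u1 u2; split=> [T [bijT TG] | T T' eT iT eT' iT'].
    have u2' : unitary_repr rho2' form2.
      move=> g Gg; apply: u2.
      by rewrite -(isom_im alpha_iso) mem_morphim.
    have nzTv0 : T v0 != 0.
      by rewrite -(linear0 T) (inj_eq (bij_inj bijT)).
    (* The ratio of [form1] to the pullback of [form2] along [T], read off at [v0]; as it is
       positive, scaling [T] by its square root makes the forms match. *)
    pose r := form1 v0 v0 / form2 (T v0) (T v0).
    have r_gt0 : 0 < r by rewrite divr_gt0 ?dnorm_gt0.
    exists (sqrtC r); first by rewrite sqrtC_eq0 gt_eqF.
    move=> u w; rewrite !scale_lfunE linearZl_LR linearZr_LR /= mulrA.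
    rewrite -normCK ger0_norm ?sqrtC_ge0 ?ltW // sqrtCK.
    apply: (mulIf (x := form2 (T v0) (T v0))); first by rewrite dnorm_eq0.
    rewrite -(unitary_form_proportional v0 u w irr1 u1 u2' TG) /r.
    by rewrite mulrAC divfK ?dnorm_eq0.
  have [c nzc T'E] := uniqT _ _ eT eT'; exists c => //.
  (* Both isometries preserve the nonzero norm of [v0], while scaling by [c] multiplies it by the
     square of the modulus. *)
  have normc2 : `|c| ^+ 2 = 1.
    apply: (mulIf (x := form1 v0 v0)); first by rewrite dnorm_eq0.
    rewrite mul1r -[RHS]iT' T'E !scale_lfunE linearZl_LR linearZr_LR /= mulrA.
    by rewrite -normCK iT.
  by apply/eqP; rewrite -sqrp_eq1 ?normr_ge0 // normc2.
Qed.
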